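(* Let $\mathcal{B}_{\mathcal G'}$ be the set of partitions $\lambda=(\lambda_1\ge\lambda_2\ge\cdots\ge\lambda_\ell)$ into positive parts such that $3\le\lambda_{2i-1}-\lambda_{2i}\le4$ whenever $2i\le\ell$, $\lambda_{2i}=\lambda_{2i+1}$ whenever $2i+1\le\ell$, and the smallest part $\lambda_\ell$ is $3$ or $4$ if $\ell$ is odd and equals $2$ if $\ell$ is even. For a partition let $|\lambda_o|=\lambda_1+\lambda_3+\cdots$ and $|\lambda_e|=\lambda_2+\lambda_4+\cdots$. For integers $n,h$ let $B_{G'}(n,h)=\sum x^{|\lambda_o|}y^{|\lambda_e|}$, the sum over all $\lambda\in\mathcal{B}_{\mathcal G'}$ with exactly $n$ parts and largest part $h$. Then for all integers $n\ge1$ and $h\ge0$, $$B_{G'}(2n-1,3n+h)=x^{\frac{3n^2+3n}{2}+\frac{h^2+h}{2}}y^{\frac{3n^2-3n}{2}+\frac{h^2-h}{2}}{n\brack h}_{xy},\qquad B_{G'}(2n,3n+h+2)=x^{\frac{3n^2+7n}{2}+\frac{h^2+h}{2}}y^{\frac{3n^2+n}{2}+\frac{h^2-h}{2}}{n\brack h}_{xy}.$$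
   Context: The Gaussian coefficient is ${a+b\brack b}_t=\frac{(t;t)_{a+b}}{(t;t)_a(t;t)_b}$ if $a,b\ge0$ and $0$ otherwise, with $(a;t)_n=\prod_{i=0}^{n-1}(1-at^i)$; here $t=xy$. *)

(* Defs.v *)
From HB Require Import structures.
From mathcomp Require Import all_boot all_order all_algebra.
From mathcomp Require Import fraction.
From mathcomp Require Import mpoly.

Set Implicit Arguments.
Unset Strict Implicit.
Unset Printing Implicit Defensive.

Import GRing.Theory.
Local Open Scope ring_scope.

Section PartitionStatistics.
Local Open Scope nat_scope.

(* Parts are numbered from 1, so [part lam i] is meaningful for i >= 1. *)
Definition part (lam : seq nat) (i : nat) : nat := nth 0 lam i.-1.

Definition is_partition (lam : seq nat) : bool :=
  sorted geq lam && all (fun p => 0 < p) lam.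

Definition odd_weight (lam : seq nat) : nat :=
  \sum_(1 <= i < (size lam).+1 | odd i) part lam i.

Definition even_weight (lam : seq nat) : nat :=
  \sum_(1 <= i < (size lam).+1 | ~~ odd i) part lam i.

(* Restricting the index i to 1..l loses nothing: each condition is required
   only when 2i <= l or 2i+1 <= l. The empty sequence has no smallest part and
   is rejected by the last clause. *)
Definition in_BG' (lam : seq nat) : bool :=
  let l := size lam in
  [&& is_partition lam,
      all (fun i => (2 * i <= l) ==>
             (3 <= part lam (2 * i - 1) - part lam (2 * i) <= 4)) (iota 1 l),
      all (fun i => (2 * i + 1 <= l) ==>
             (part lam (2 * i) == part lam (2 * i + 1))) (iota 1 l)
    & if odd l then (part lam l == 3) || (part lam l == 4)
      else part lam l == 2].

End PartitionStatistics.

Notation Zxy := {mpoly int[2]}.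

Definition x : Zxy := 'X_(0 : 'I_2).
Definition y : Zxy := 'X_(1 : 'I_2).

(* A partition with exactly n parts and largest part h is an n-tuple of numbers
   in 0..h whose first entry is h, so the sum is over a finite type. *)
Definition BG' (n h : nat) : Zxy :=
  \sum_(lam : n.-tuple 'I_h.+1 |
          in_BG' (map val lam) && (part (map val lam) 1 == h))
     x ^+ odd_weight (map val lam) * y ^+ even_weight (map val lam).

Definition qpoch (F : fieldType) (a t : F) (n : nat) : F :=
  \prod_(i < n) (1 - a * t ^+ i).

(* [gauss t m b] has m on top and b below: m = a + b with a = m - b. *)
Definition gauss (F : fieldType) (t : F) (m b : int) : F :=
  let a := m - b in
  if (0 <= a) && (0 <= b)
  then qpoch t t `|m|%N / (qpoch t t `|a|%N * qpoch t t `|b|%N)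
  else 0.

(* Main.v *)
(* Removing the two largest parts a >= b of a partition in B_G' leaves a member
   whose largest part is b, and a - b is 3 or 4; so if its largest part is
   3n + h, the new one is 3(n+1) + h + e with e = 0 or 1. Hence the generating
   functions satisfy
     B(2n+1, 3(n+1)+h) = x^(3(n+1)+h) (y^(3n+h) B(2n-1, 3n+h)
                                       + y^(3n+h-1) B(2n-1, 3n+h-1)),
   and likewise for an even number of parts. After the monomial prefactor is
   divided out, this is the q-Pascal rule
     [n+1, h] = t^h [n, h] + [n, h-1],   t = xy. *)

Require Import Defs.
From HB Require Import structures.
From mathcomp Require Import all_boot all_order all_algebra.
From mathcomp Require Import fraction.
From mathcomp Require Import mpoly.
From mathcomp Require Import zify ring.

Import GRing.Theory.
Local Open Scope ring_scope.

(** * The q-Pascal rule for Gaussian coefficients *)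

Section GaussPascal.

Variables (F : fieldType) (t : F).
Hypothesis t_not_root : forall k, 1 - t ^+ k.+1 != 0.

Lemma qpochS n : qpoch t t n.+1 = qpoch t t n * (1 - t ^+ n.+1).
Proof. by rewrite /qpoch big_ord_recr /= -exprS. Qed.

Lemma qpoch_neq0 n : qpoch t t n != 0.
Proof. by apply/prodf_neq0 => i _; rewrite -exprS. Qed.

Lemma gauss_nat (n h : nat) :
  gauss t n h =
    if (h <= n)%N then qpoch t t n / (qpoch t t (n - h)%N * qpoch t t h)
    else 0.
Proof.
rewrite /gauss Num.Theory.subr_ge0 lez_nat (_ : 0 <= h%:Z = true) // andbT.
by case: leqP => // le_hn; rewrite subzn.
Qed.

Lemma gauss0 (n : nat) : gauss t n 0%N = 1.
Proof.
rewrite gauss_nat leq0n subn0 {3}/qpoch big_ord0 mulr1.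
by rewrite divff ?qpoch_neq0.
Qed.

Lemma gauss_pascal (n h : nat) :
  gauss t n.+1 h.+1 = t ^+ h.+1 * gauss t n h.+1 + gauss t n h.
Proof.
rewrite !gauss_nat ltnS subSS.
case: (ltngtP h n) => [lt_hn|lt_nh|->]; last 2 first.
- by rewrite mulr0 addr0.
- rewrite mulr0 add0r subnn /qpoch big_ord0 -/(qpoch t t n) !mul1r.
  by rewrite !divff ?qpoch_neq0.
(* Case h < n. Writing n = h+m+1 removes truncated subtraction, and the rule reduces to 1 -
   t^(h+m+2) = t^(h+1) (1 - t^(m+1)) + (1 - t^(h+1)). *)
have [m ->] : exists m, n = (h + m.+1)%N by exists (n - h.+1)%N; lia.
rewrite (_ : h + m.+1 - h = m.+1)%N; last by lia.
rewrite (_ : h + m.+1 - h.+1 = m)%N; last by lia.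
rewrite !qpochS (_ : (h + m.+1).+1 = (h.+1 + m.+1)%N) // exprD.
by field; rewrite !qpoch_neq0 !t_not_root.
Qed.

End GaussPascal.

(** * Removal of the two largest parts *)

Section Recursion.
Local Open Scope nat_scope.

Lemma odd_weight_cons2 a b s : odd_weight [:: a, b & s] = a + odd_weight s.
Proof.
rewrite /odd_weight /= big_ltn_cond //= big_ltn_cond //=; congr (_ + _).
by rewrite !big_add1 /=; apply: eq_big => i /=; rewrite ?negbK.
Qed.

Lemma even_weight_cons2 a b s : even_weight [:: a, b & s] = b + even_weight s.
Proof.
rewrite /even_weight /= big_ltn_cond //= big_ltn_cond //=; congr (_ + _).
by rewrite !big_add1 /=; apply: eq_big => i /=; rewrite ?negbK.
Qed.

Lemma part_cons2 a b s i : 0 < i -> part [:: a, b & s] i.+2 = part s i.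
Proof. by case: i. Qed.

(** Dropping two parts lowers the index i by one but shortens the range by two, so [P] must also
    hold at the surplus top index, where the conditions of [in_BG'] are vacuous. *)
Lemma all_iota_shift (P Q : pred nat) l :
    P l.+2 -> (forall i, 0 < i -> P i.+1 = Q i) ->
  all P (iota 1 l.+2) = P 1 && all Q (iota 1 l).
Proof.
move=> Plast PQ; rewrite -[iota 1 l.+2]/([:: 1] ++ iota (1 + 1) l.+1).
rewrite all_cat all_seq1 iotaDl all_map; congr (_ && _).
have -> : iota 1 l.+1 = rcons (iota 1 l) l.+1 by rewrite -cats1 -{1}(addn1 l) iotaD.
rewrite all_rcons /= Plast /=.
by apply: eq_in_all => i; rewrite mem_iota => /andP[i1 _] /=; rewrite PQ.
Qed.

(** Only when a third part [c] exists is its equality with [b] required. The order and positivity of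
    [a] and [b] then follow from the gap and the tail, and the parity of the length is unchanged. *)
Lemma in_BG'_cons3 a b c s :
  in_BG' [:: a, b, c & s] = [&& 3 <= a - b <= 4, b == c & in_BG' (c :: s)].
Proof.
rewrite /in_BG' -[size [:: a, b, c & s]]/(size (c :: s)).+2.
have: 0 < size (c :: s) by [].
move: (size (c :: s)) => l l_gt0.
rewrite (all_iota_shift _ (fun i => (2 * i <= l) ==>
    (3 <= part (c :: s) (2 * i - 1) - part (c :: s) (2 * i) <= 4))); first last.
- move=> i i1; rewrite -!(part_cons2 a b (c :: s)); try lia.
  rewrite (_ : 2 * i.+1 = (2 * i).+2) ?ltnS; last by lia.
  by rewrite (_ : (2 * i).+2 - 1 = (2 * i - 1).+2) //; lia.
- by lia.
rewrite (all_iota_shift _ (fun i => (2 * i + 1 <= l) ==>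
    (part (c :: s) (2 * i) == part (c :: s) (2 * i + 1)))); first last.
- move=> i i1; rewrite -!(part_cons2 a b (c :: s)); try lia.
  rewrite (_ : 2 * i.+1 = (2 * i).+2) ?ltnS; last by lia.
  by rewrite (_ : (2 * i).+2 + 1 = (2 * i + 1).+2).
- by lia.
rewrite part_cons2 // [odd l.+2]/= negbK !muln1.
have -> : 2 <= l.+2 by [].
have -> : 2 + 1 <= l.+2 by [].
rewrite /= -[part _ (2 - 1)]/a -[part _ 2]/b -[part _ (2 + 1)]/c.
rewrite /is_partition /=.
case: (eqVneq b c) => [->|_] /=; last by rewrite !andbF.
case gap: (2 < a - c <= 4) => /=; last by rewrite andbF.
have [-> -> ->] : [/\ c <= a, c <= c & 0 < a] by split; lia.
by rewrite !andbA; case: (0 < c); rewrite ?andbF ?andbT.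
Qed.

(** * Listing the partitions by length and largest part *)

Section Enumeration.

Variables (c : nat) (r : seq nat).

(* With (c, r) = (0, [::]) or (2, [:: 2]), [BG'_seq n h] lists the partitions
   counted by B(2n+1, 3(n+1)+h), resp. B(2n+2, 3(n+1)+h+2): [n] is one less
   than in the theorem, and h counts the differences equal to 4. *)
Fixpoint BG'_seq (n h : nat) : seq (seq nat) :=
  if n is m.+1 then
    let step s := [:: 3 * n.+1 + h + c, head 0 s & s] in
    map step (BG'_seq m h) ++ (if h is h'.+1 then map step (BG'_seq m h') else [::])
  else if h <= 1 then [:: (3 + h + c) :: r] else [::].

Hypothesis in_BG'_base : forall s, size s = (size r).+1 ->
  in_BG' s = (s == (3 + c) :: r) || (s == (4 + c) :: r).

(** Each removed pair lowers the largest part by at least 3. The bound serves to exclude a gap of 4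
    when h = 0. *)
Lemma head_in_BG'_ge n s : size s = 2 * n + (size r).+1 -> in_BG' s ->
  3 * n.+1 + c <= head 0 s.
Proof.
elim: n s => [|n IHn] s.
  by move=> /in_BG'_base-> /orP[]/eqP-> /=; lia.
case: s => [|a [|b [|d s]]] //; try by rewrite /=; lia.
move=> sz; rewrite in_BG'_cons3 => /and3P[gap /eqP eq_bd /IHn/=].
by move: sz gap => /= *; lia.
Qed.

Lemma mem_BG'_seq n h s : (s \in BG'_seq n h) =
  [&& size s == 2 * n + (size r).+1, in_BG' s & head 0 s == 3 * n.+1 + h + c].
Proof.
elim: n h s => [|n IHn] h s.
  have [sz|sz] := eqVneq (size s); last first.
    rewrite /=; case: ifP => // _; rewrite inE; apply: contraNF sz => /eqP->.
    exact/eqP.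
  rewrite in_BG'_base //= muln1; case: ifP => [|h1].
    case: h => [|[|]] // _; rewrite inE.
    - rewrite addn0; case: eqVneq => [->|_] /=; first by rewrite eqxx.
      by case: eqVneq => [->|_] //=; lia.
    - rewrite orbC -[3 + 1]/4; case: eqVneq => [->|_] /=; first by rewrite eqxx.
      by case: eqVneq => [->|_] //=; lia.
  by apply/esym/andP => -[/orP[]/eqP-> /= /eqP]; lia.
apply/idP/and3P.
  rewrite /= mem_cat => /orP[/mapP[t]|].
    rewrite IHn; case: t => [|d t]; first by rewrite addnS.
    move=> /and3P[/eqP sz inB /eqP/= hd] ->; split; last by [].
    - by rewrite /= in sz *; lia.
    - by rewrite in_BG'_cons3 inB eqxx /= hd; lia.
  case: h => [|h] // /mapP[t]; rewrite IHn; case: t => [|d t]; first by rewrite addnS.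
  move=> /and3P[/eqP sz inB /eqP/= hd] ->; split; last by [].
  - by rewrite /= in sz *; lia.
  - by rewrite in_BG'_cons3 inB eqxx /= hd; lia.
case: s => [|a [|b [|d s]]] [/eqP sz]; try by move: sz; rewrite /=; lia.
rewrite in_BG'_cons3 => /and3P[gap /eqP eq_bd inB] /eqP/= hd.
have sz' : size (d :: s) = 2 * n + (size r).+1 by move: sz; rewrite /=; lia.
have := head_in_BG'_ge _ _ sz' inB; rewrite /= mem_cat => le_d.
(* A gap of 3 keeps h and falls in the first half of the list; a gap of 4 lowers h by one and falls
   in the second. *)
apply/orP; have [a3|a4] : a - b = 3 \/ a - b = 4 by lia.
  left; apply/mapP; exists (d :: s); last by rewrite hd eq_bd.
  by rewrite IHn sz' inB eqxx /=; lia.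
case: h hd => [|h] hd; first by lia.
right; apply/mapP; exists (d :: s); last by rewrite hd eq_bd.
by rewrite IHn sz' inB eqxx /=; lia.
Qed.

(** The two halves are disjoint because the largest part of the tail, determined by h, differs
    between them. *)
Lemma BG'_seq_uniq n h : uniq (BG'_seq n h).
Proof.
elim: n h => [|n IHn] h /=; first by case: ifP.
have stepI k : injective (fun s : seq nat => [:: k, head 0 s & s]) by move=> s t [].
rewrite cat_uniq map_inj_uniq // IHn /=; case: h => [//|h].
rewrite map_inj_uniq // IHn andbT; apply/hasPn => _ /mapP[s s_in ->].
apply/mapP => -[t t_in /stepI eq_st]; move: s_in t_in; rewrite -eq_st !mem_BG'_seq.
by move=> /and3P[_ _ /eqP->] /and3P[_ _ /eqP]; lia.
Qed.

Lemma BG'_sum_seq n h :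
  BG' (2 * n + (size r).+1) (3 * n.+1 + h + c) =
    (\sum_(s <- BG'_seq n h) x ^+ odd_weight s * y ^+ even_weight s)%R.
Proof.
set m := 2 * n + _; set k := 3 * n.+1 + h + c.
rewrite /BG' -(big_map (fun lam : m.-tuple 'I_k.+1 => map val lam)
  (fun s => in_BG' s && (part s 1 == k))
  (fun s => (x ^+ odd_weight s * y ^+ even_weight s)%R)) -big_filter.
apply/perm_big/uniq_perm; [|exact: BG'_seq_uniq|move=> s].
  rewrite filter_uniq // map_inj_uniq ?index_enum_uniq // => u v.
  by move=> /(inj_map val_inj)/val_inj.
rewrite mem_filter mem_BG'_seq -/m -/k andbC.
have -> : part s 1 = head 0 s by case: s.
apply/andP/and3P => [[/mapP[u _ ->] /andP[-> ->]]|[/eqP sz inB /eqP hd]].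
  by rewrite size_map size_tuple.
rewrite inB hd eqxx; split=> //.
(* The first part [k] bounds all others, so the partition lifts to a tuple over ['I_k.+1]. *)
have le_k : {in s, forall p, p < k.+1}.
  move=> p; case: s hd {sz} inB => [|a s] //= -> /andP[/andP[srt _] _].
  rewrite inE ltnS => /predU1P[->//|].
  have geq_trans : transitive geq by move=> u v w /= vu wv; apply: leq_trans wv vu.
  by move/(order_path_min geq_trans)/allP: srt; apply.
have szu : size (map (@inord k) s) == m by rewrite size_map sz.
apply/mapP; exists (Tuple szu); first exact: mem_index_enum.
rewrite /= -map_comp -[LHS]map_id; apply/eq_in_map => p /le_k lt_pk /=.
by rewrite inordK.
Qed.

(** * Closed form of the generating function over a field *)

Section GeneratingFunction.
Local Open Scope ring_scope.

Variables (F : fieldType) (X Y : F).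
Hypothesis XY_not_root : forall k, 1 - (X * Y) ^+ k.+1 != 0.
Hypothesis odd_weight_base : forall a, odd_weight (a :: r) = a.
Hypothesis even_weight_base : forall a, even_weight (a :: r) = c.

Let gf n h := \sum_(s <- BG'_seq n h) X ^+ odd_weight s * Y ^+ even_weight s.

Lemma gf_step n h (top := (3 * n.+2 + h + c)%N) :
  gf n.+1 h = X ^+ top * (Y ^+ (3 * n.+1 + h + c)%N * gf n h
    + (if h is h'.+1 then Y ^+ (3 * n.+1 + h' + c)%N * gf n h' else 0)).
Proof.
have part_sum h' :
    \sum_(s <- map (fun s => [:: top, head 0%N s & s]) (BG'_seq n h'))
      X ^+ odd_weight s * Y ^+ even_weight s =
    X ^+ top * (Y ^+ (3 * n.+1 + h' + c)%N * gf n h').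
  rewrite big_map /gf !big_distrr /= big_seq [RHS]big_seq.
  (* Membership fixes the head of [s], which is repeated as the new second part and so yields a
     constant power of [Y]. *)
  apply: eq_bigr => s; rewrite mem_BG'_seq => /and3P[_ _ /eqP hd].
  by rewrite odd_weight_cons2 even_weight_cons2 hd !exprD; ring.
rewrite /gf [BG'_seq n.+1 h]/= big_cat /= part_sum mulrDr; congr (_ + _).
by case: h @top part_sum => [|h] top part_sum; rewrite ?big_nil ?mulr0 // part_sum.
Qed.

(** Binomial exponents satisfy additive recurrences, with no halving; [c] = 0 and [c] = 2 give the
    two parities. *)
Lemma gf_closed n h :
  gf n h = X ^+ (3 * 'C(n.+2, 2) + c * n.+1 + 'C(h.+1, 2))%N
           * Y ^+ (3 * 'C(n.+1, 2) + c * n.+1 + 'C(h, 2))%N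
           * gauss (X * Y) n.+1 h.
Proof.
elim: n h => [|n IHn] h.
  rewrite /gf /=; case: h => [|[|h]] /=.
  - rewrite big_seq1 odd_weight_base even_weight_base gauss0 // mulr1.
    by congr (X ^+ _ * Y ^+ _); rewrite ?binE /=; lia.
  - rewrite big_seq1 odd_weight_base even_weight_base gauss_pascal //.
    rewrite gauss0 // gauss_nat /= mulr0 add0r mulr1.
    by congr (X ^+ _ * Y ^+ _); rewrite ?binE /=; lia.
  - by rewrite big_nil gauss_nat mulr0.
have collect a b d e (g : F) :
    X ^+ a * (Y ^+ b * (X ^+ d * Y ^+ e * g)) = X ^+ (a + d)%N * Y ^+ (b + e)%N * g.
  by rewrite !exprD; ring.
have absorb a b k (g : F) :
    X ^+ a * Y ^+ b * ((X * Y) ^+ k * g) = X ^+ (a + k)%N * Y ^+ (b + k)%N * g.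
  by rewrite exprMn !exprD; ring.
have binS2 k : 'C(k.+1, 2) = (k + 'C(k, 2))%N by rewrite binS bin1 addnC.
rewrite gf_step IHn; case: h => [|h].
  by rewrite !gauss0 // addr0 collect !binS2; congr (X ^+ _ * Y ^+ _ * _); lia.
(* The q-Pascal term carrying (XY)^(h+1) matches the gap 3, the other term the gap 4. *)
rewrite (@gauss_pascal _ _ XY_not_root n.+1) IHn [RHS]mulrDr mulrDr !collect; congr (_ + _).
  by rewrite absorb !binS2; congr (X ^+ _ * Y ^+ _ * _); lia.
by rewrite !binS2; congr (X ^+ _ * Y ^+ _ * _); lia.
Qed.

End GeneratingFunction.

End Enumeration.

End Recursion.

(** * Specialization to the fraction field of the polynomial ring *)

(** At x = y = 0 the polynomial takes the value 1, so it is nonzero, and [tofrac] is injective. *)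
Lemma xy_not_root k : 1 - tofrac (x * y) ^+ k.+1 != 0.
Proof.
rewrite -tofrac1 -tofracXn -tofracB tofrac_eq0; apply/eqP.
move/(congr1 (meval (fun=> 0))).
rewrite rmorphB rmorph1 rmorphXn rmorphM /= !mevalXU meval0.
by rewrite mul0r expr0n subr0.
Qed.

Lemma tofrac_BG' c r n h :
    (forall s, size s = (size r).+1 ->
       in_BG' s = (s == (3 + c)%N :: r) || (s == (4 + c)%N :: r)) ->
    (forall a, odd_weight (a :: r) = a) -> (forall a, even_weight (a :: r) = c) ->
  tofrac (BG' (2 * n + (size r).+1)%N (3 * n.+1 + h + c)%N) =
    tofrac (x ^+ (3 * 'C(n.+2, 2) + c * n.+1 + 'C(h.+1, 2))%N
            * y ^+ (3 * 'C(n.+1, 2) + c * n.+1 + 'C(h, 2))%N)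
    * gauss (tofrac (x * y)) n.+1 h.
Proof.
move=> base odd_base even_base.
have not_root k : 1 - (tofrac x * tofrac y) ^+ k.+1 != 0 :> {fraction Zxy}.
  by rewrite -tofracM xy_not_root.
rewrite (BG'_sum_seq _ _ base) rmorph_sum /= !tofracM !tofracXn.
rewrite -(gf_closed _ _ base _ _ _ not_root odd_base even_base).
by apply: eq_bigr => s _; rewrite tofracM !tofracXn.
Qed.

Lemma in_BG'_size1 s : size s = 1%N ->
  in_BG' s = (s == [:: 3]) || (s == [:: 4]).
Proof.
case: s => [|a []] // _; rewrite /in_BG' /= !eqseq_cons !andbT.
by rewrite /part /is_partition /=; lia.
Qed.

Lemma in_BG'_size2 s : size s = 2%N ->
  in_BG' s = (s == [:: 5; 2]) || (s == [:: 6; 2]).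
Proof.
case: s => [|a [|b []]] // _; rewrite /in_BG' /= !eqseq_cons !andbT.
by rewrite /part /is_partition /=; lia.
Qed.

Theorem theorem5p8 (n h : nat) (hn : (1 <= n)%N) :
  tofrac (BG' (2 * n - 1)%N (3 * n + h)%N)
    = tofrac (x ^+ ((3 * n ^ 2 + 3 * n) %/ 2 + (h ^ 2 + h) %/ 2)%N
              * y ^+ ((3 * n ^ 2 - 3 * n) %/ 2 + (h ^ 2 - h) %/ 2)%N)
      * gauss (tofrac (x * y)) n%:Z h%:Z
      :> {fraction {mpoly int[2]}}
  /\
  tofrac (BG' (2 * n)%N (3 * n + h + 2)%N)
    = tofrac (x ^+ ((3 * n ^ 2 + 7 * n) %/ 2 + (h ^ 2 + h) %/ 2)%N
              * y ^+ ((3 * n ^ 2 + n) %/ 2 + (h ^ 2 - h) %/ 2)%N)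
      * gauss (tofrac (x * y)) n%:Z h%:Z
      :> {fraction {mpoly int[2]}}.
Proof.
case: n hn => // n _.
(* The bound [k <= k ^ 2] ensures that [k ^ 2 - k] is not truncated. *)
have bin2S k : (k ^ 2 + k = 2 * 'C(k.+1, 2) /\ k ^ 2 - k = 2 * 'C(k, 2) /\ k <= k ^ 2)%N.
  elim: k => // k IHk.
  rewrite (binS k.+1 1) bin1 (binS k 1) bin1; nia.
have [h1 [h2 _]] := bin2S h; have [n1 [n2 n3]] := bin2S n.+1.
split.
  (* Odd length: removing pairs ends at a single part 3 or 4. *)
  have := @tofrac_BG' 0 [::] n h in_BG'_size1.
  rewrite addn0 (_ : 2 * n + _ = 2 * n.+1 - 1)%N; last by rewrite /=; lia.
  move=> ->.
  - by congr (tofrac (x ^+ _ * y ^+ _) * _); lia.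
  - by move=> a; rewrite /odd_weight unlock /= ?addn0.
  - by move=> a; rewrite /even_weight unlock /= ?addn0.
(* Even length: removing pairs ends at (5, 2) or (6, 2), so the leading part is shifted by [c] =
   2. *)
have := @tofrac_BG' 2 [:: 2%N] n h in_BG'_size2.
rewrite (_ : 2 * n + _ = 2 * n.+1)%N; last by rewrite /=; lia.
move=> ->.
- by congr (tofrac (x ^+ _ * y ^+ _) * _); lia.
- by move=> a; rewrite /odd_weight unlock /= ?addn0.
- by move=> a; rewrite /even_weight unlock /= ?addn0.
Qed.
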